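(* Let $d\in\mathbb{N}$. For every $1$-type $\tau$, $\tau$-neighbourhood freeness is uniformly testable on the class $\mathcal{C}_d$ with constant running time.
   Context: $\mathcal{C}_d$ is the class of finite simple undirected graphs of maximum degree at most $d$. For a graph $G$ and vertex $v$, $N_1^G(v)$ is $v$ together with its neighbours and $\mathcal{N}_1^G(v)$ the subgraph induced by it. A $1$-ball is a pair $(B,b)$ of a graph $B$ and $b\in V(B)$ with every vertex of $B$ at distance at most $1$ from $b$; $1$-balls are isomorphic if some graph isomorphism maps centre to centre. A $1$-type is an isomorphism class of $1$-balls; $v$ has type $\tau$ in $G$ if $(\mathcal{N}_1^G(v),v)\in\tau$. $G$ is $\tau$-neighbourhood free if no vertex of $G$ has type $\tau$. A graph on $n$ vertices is $\epsilon$-far from a property if more than $\epsilon dn$ edge insertions/deletions are needed to obtain an $n$-vertex graph with the property. The algorithm gets $n$ and oracle access answering queries $(v,i)$, $i\le d$, with the $i$-th neighbour of $v$ (or a special symbol). Uniformly testable with constant running time means: there is a single probabilistic algorithm which, given $\epsilon\in(0,1]$, $n$ and oracle access to $G\in\mathcal{C}_d$ on $n$ vertices, accepts with probability at least $2/3$ if $G$ has the property and rejects with probability at least $2/3$ if $G$ is $\epsilon$-far from it, with running time bounded by a function of $\epsilon$ (for fixed $d,\tau$), independent of $n$. *)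

(* Defs.v *)
From mathcomp Require Import all_boot all_order all_algebra.
From mathcomp Require Import reals.
Set Implicit Arguments.
Unset Strict Implicit.
Unset Printing Implicit Defensive.
Import Order.TTheory GRing.Theory Num.Theory.
Local Open Scope ring_scope.

Record sgraph (V : finType) := SGraph {
  edge : V -> V -> bool;
  edge_sym : symmetric edge;
  edge_irr : irreflexive edge }.

Coercion edge : sgraph >-> Funclass.

Definition neighbours (V : finType) (G : sgraph V) (v : V) : {set V} :=
  [set u | G v u].

Definition max_degree_le (d : nat) (V : finType) (G : sgraph V) : Prop :=
  forall v, (#|neighbours G v| <= d)%N.

Section Induced.
Variables (V : finType) (G : sgraph V) (A : {set V}).
Definition induced_edge : rel {x : V | x \in A} := fun x y => G (val x) (val y).
Lemma induced_sym : symmetric induced_edge.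
Proof. by move=> x y; apply: edge_sym. Qed.
Lemma induced_irr : irreflexive induced_edge.
Proof. by move=> x; apply: edge_irr. Qed.
Definition induced : sgraph {x : V | x \in A} := SGraph induced_sym induced_irr.
End Induced.

Record ball1 := Ball1 {
  ball_vertex : finType;
  ball_graph : sgraph ball_vertex;
  ball_centre : ball_vertex;
  ball_radius : forall x, x = ball_centre \/ ball_graph ball_centre x }.

Definition ball_iso (B C : ball1) : Prop :=
  exists f : ball_vertex B -> ball_vertex C,
    [/\ bijective f,
        forall x y, ball_graph C (f x) (f y) = ball_graph B x y
      & f (ball_centre B) = ball_centre C].

Record type1 := Type1 {
  type_class : ball1 -> Prop;
  type_classP : exists B, forall C, type_class C <-> ball_iso B C }.

Section Neighbourhood.
Variables (V : finType) (G : sgraph V) (v : V).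
Definition closed_nbhd : {set V} := v |: neighbours G v.
Definition nbhd_graph : sgraph {x : V | x \in closed_nbhd} :=
  induced G closed_nbhd.
Definition nbhd_centre : {x : V | x \in closed_nbhd} :=
  exist _ v (setU11 v (neighbours G v)).
Lemma nbhd_radius x : x = nbhd_centre \/ nbhd_graph nbhd_centre x.
Proof.
case: x => x xN; have := xN; rewrite !inE => /orP[/eqP xv|Gvx].
  by left; apply: val_inj.
by right.
Qed.
Definition nbhd_ball : ball1 := Ball1 nbhd_radius.
End Neighbourhood.

Definition has_type (tau : type1) (V : finType) (G : sgraph V) (v : V) : Prop :=
  type_class tau (nbhd_ball G v).

Definition graph_property := forall V : finType, sgraph V -> Prop.

Definition nbhd_free (tau : type1) : graph_property :=
  fun V G => forall v : V, ~ has_type tau G v.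

Definition edges (V : finType) (G : sgraph V) : {set {set V}} :=
  [set [set p.1; p.2] | p : V * V & G p.1 p.2].

(* Least number of edge insertions and deletions turning G into H. *)
Definition edit_distance (V : finType) (G H : sgraph V) : nat :=
  (#|edges G :\: edges H| + #|edges H :\: edges G|)%N.

(* A property of graphs in C_d is a subclass of C_d, so the modified graph must
   have maximum degree at most d as well.  If no such graph has the property,
   then every graph is far from it. *)
Definition far (R : realType) (d : nat) (P : graph_property) (eps : R)
    (n : nat) (G : sgraph 'I_n) : Prop :=
  forall H : sgraph 'I_n, max_degree_le d H -> P 'I_n H ->
    eps * d%:R * n%:R < (edit_distance G H)%:R.

(* Adjacency lists, in an arbitrary order, of a graph on {0, ..., n-1}. *)
Definition adjacency_lists (n : nat) (G : sgraph 'I_n)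
    (adj : 'I_n -> seq 'I_n) : Prop :=
  forall v, uniq (adj v) /\ adj v =i neighbours G v.

(* The answer to the query (v, i), with indices starting at 0: u.+1 if u is the
   i-th neighbour of v, and 0 (the special symbol) if v has no i-th neighbour
   or is not a vertex. *)
Definition oracle (n : nat) (adj : 'I_n -> seq 'I_n) (v i : nat) : nat :=
  if insub v is Some v' then
    if onth (adj v') i is Some u then (nat_of_ord u).+1 else 0%N
  else 0%N.

(* Algorithms are programs of a probabilistic random access machine with
   oracle, whose memory cells hold natural numbers.  The arithmetic is addition,
   truncated subtraction and halving (rounded down), so that in t steps numbers
   only grow by O(t) bits.  A command is executed in one step; since expressions
   have a size fixed by the program, this is the usual unit-cost measure up to
   a constant factor. *)
Inductive expr :=
| Const of nat
| Cell of expr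
| Plus of expr & expr
| Minus of expr & expr
| Half of expr.

Inductive cmd :=
| Store of expr & expr           (* M[a] := e *)
| Rand of expr & expr            (* M[a] := uniform in {0, ..., e-1}; 0 if e = 0 *)
| Query of expr & expr & expr    (* M[a] := oracle answer to (v, i) *)
| CmpEps of expr & expr & expr   (* M[a] := 1 if eps * x <= y, else 0 *)
| Seq of cmd & cmd
| If of expr & cmd & cmd         (* nonzero is true *)
| While of expr & cmd.

Definition memory := nat -> nat.

Fixpoint eval (m : memory) (e : expr) : nat :=
  match e with
  | Const k => k
  | Cell a => m (eval m a)
  | Plus e1 e2 => eval m e1 + eval m e2
  | Minus e1 e2 => eval m e1 - eval m e2
  | Half e1 => (eval m e1)./2
  end%N.

Definition update (m : memory) (a x : nat) : memory :=
  fun b => if b == a then x else m b.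

(* The commands still to be executed, and the memory.  The machine halts when
   no command is left. *)
Definition config : Type := seq cmd * memory.

Section Semantics.
Variables (R : realType) (eps : R) (query : nat -> nat -> nat).

(* The successors of a non-halted configuration, each of them equally likely.
   The real parameter eps is accessible through comparisons only. *)
Definition step (c : cmd) (k : seq cmd) (m : memory) : seq config :=
  match c with
  | Store a e => [:: (k, update m (eval m a) (eval m e))]
  | Rand a e =>
      if eval m e is 0%N then [:: (k, update m (eval m a) 0%N)]
      else [seq (k, update m (eval m a) x) | x <- iota 0 (eval m e)]
  | Query a v i =>
      [:: (k, update m (eval m a) (query (eval m v) (eval m i)))]
  | CmpEps a x y =>
      [:: (k, update m (eval m a)
                (eps * (eval m x)%:R <= (eval m y)%:R :> R))]
  | Seq c1 c2 => [:: ([:: c1, c2 & k], m)]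
  | If e c1 c2 => [:: ((if eval m e != 0%N then c1 else c2) :: k, m)]
  | While e c1 =>
      [:: (if eval m e != 0%N then [:: c1, c & k] else k, m)]
  end.

(* Worst case over the random choices. *)
Fixpoint halts_within (t : nat) (s : config) : bool :=
  match s with
  | ([::], _) => true
  | (c :: k, m) =>
      if t is t'.+1 then all (halts_within t') (step c k m) else false
  end.

(* Probability of halting within t steps with output b, where the output is
   true (accept) if cell 0 is nonzero, and false (reject) otherwise. *)
Fixpoint prob_output (b : bool) (t : nat) (s : config) : R :=
  match s with
  | ([::], m) => ((m 0%N != 0%N) == b)%:R
  | (c :: k, m) =>
      if t is t'.+1 then
        (\sum_(s' <- step c k m) prob_output b t' s') / (size (step c k m))%:R
      else 0
  end.
End Semantics.

(* Cell 0 initially holds n, all the other cells hold 0. *)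
Definition start (p : cmd) (n : nat) : config :=
  ([:: p], fun a => if a == 0%N then n else 0%N).

Definition uniformly_testable_const_time
    (R : realType) (d : nat) (P : graph_property) : Prop :=
  exists (p : cmd) (T : R -> nat), forall eps : R, 0 < eps <= 1 ->
  forall (n : nat) (G : sgraph 'I_n) (adj : 'I_n -> seq 'I_n),
    max_degree_le d G -> adjacency_lists G adj ->
    [/\ halts_within eps (oracle adj) (T eps) (start p n),
        P 'I_n G ->
          2 / 3 <= prob_output eps (oracle adj) true (T eps) (start p n)
      & far d P eps G ->
          2 / 3 <= prob_output eps (oracle adj) false (T eps) (start p n)].

(* Main.v *)
Require Import Defs.
From mathcomp Require Import all_boot all_order all_algebra.
From mathcomp Require Import perm zify ring lra.
From mathcomp Require Import boolp reals.
Set Implicit Arguments.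
Unset Strict Implicit.
Unset Printing Implicit Defensive.
Import Order.TTheory GRing.Theory Num.Theory.

(** Let [k] be the degree of the centre of the type. A vertex [v] of that type
    ("typed") has degree [k], and editing edges at [v] changes the type of
    nothing outside the closed neighbourhood of [v].
    - If some neighbour of [v] has degree other than [k + 1], delete the edges
      from [v] to all such neighbours: none of these gets degree [k], and the
      other neighbours keep degree [k + 1], so no new typed vertex appears.
    - Otherwise [v] is "stubborn". Two stubborn typed vertices are not adjacent,
      and joining them gives both degree [k + 1] without creating a typed vertex.
    At most one typed vertex [v], a stubborn one, survives. If [k >= 2], isolate
    [v], reduce again, and join a survivor to the now isolated [v]. If [k = 1],
    the handshake lemma gives a vertex [y] of degree at least 3, and moving an
    edge [yz] to [vz] works. If [k = 0] and [d >= 2], subdivide an edge by [v];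
    for [d = 1] a single survivor forces an odd number of vertices, and then no
    graph of maximum degree [d] is free of the type.
    Hence a graph with [m] typed vertices is within [O(m)] edits of a free one
    unless no free graph on [n] vertices exists, which is read off from [n]. So a
    far graph has a fraction [Omega(eps)] of typed vertices, and sampling
    [O(1 / eps)] vertices finds one. *)

(** * Isomorphisms of 1-balls *)

Lemma ball_iso_trans C B D : ball_iso B C -> ball_iso C D -> ball_iso B D.
Proof.
case=> f [bf fE fc] [g [bg gE gc]]; exists (g \o f); split.
- exact: bij_comp.
- by move=> x y /=; rewrite gE fE.
- by rewrite /= fc.
Qed.

Lemma card_closed_nbhd (V : finType) (G : sgraph V) v :
  #|closed_nbhd G v| = #|neighbours G v|.+1.
Proof. by rewrite cardsU1 inE edge_irr. Qed.

Lemma card_nbhd_ball (V : finType) (G : sgraph V) v :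
  #|ball_vertex (nbhd_ball G v)| = #|neighbours G v|.+1.
Proof. by rewrite card_sig -card_closed_nbhd. Qed.

Lemma ball_iso_degree B (V : finType) (G : sgraph V) v :
  ball_iso B (nbhd_ball G v) -> #|neighbours G v| = #|ball_vertex B|.-1.
Proof.
by case=> f [bf _ _]; rewrite (bij_eq_card bf) card_nbhd_ball.
Qed.

(** Stated for a map between whole vertex sets, so that no subtypes appear when it is applied. The
    degree bound makes the injection between the balls a bijection. *)
Lemma nbhd_ball_iso (V V' : finType) (G : sgraph V) (G' : sgraph V') v v'
    (phi : V -> V') :
    phi v = v' ->
    {in closed_nbhd G v, forall x, phi x \in closed_nbhd G' v'} ->
    {in closed_nbhd G v &, injective phi} ->
    #|neighbours G' v'| <= #|neighbours G v| ->
    {in closed_nbhd G v &, forall x y, G' (phi x) (phi y) = G x y} ->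
  ball_iso (nbhd_ball G v) (nbhd_ball G' v').
Proof.
move=> phiv phiN phiI cardN phiE.
pose f (x : ball_vertex (nbhd_ball G v)) : ball_vertex (nbhd_ball G' v') :=
  exist _ (phi (val x)) (phiN _ (valP x)).
have fI : injective f.
  by move=> x y /(congr1 val) /= /phiI E; apply/val_inj/E; exact: valP.
exists f; split.
- by apply: inj_card_bij => //; rewrite !card_nbhd_ball.
- by move=> x y; apply: phiE; exact: valP.
- exact/val_inj.
Qed.

(** Two distinct non-adjacent vertices would both differ from the centre and make three vertices
    with it. *)
Lemma ball_graph_small (D : ball1) : #|ball_vertex D| <= 2 ->
  forall x y, ball_graph D x y = (x != y).
Proof.
move=> leD2 x y; case: eqVneq => [->|neq_xy]; first exact: edge_irr.
have [xc|cx] := ball_radius x; have [yc|cy] := ball_radius y.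
- by rewrite xc yc eqxx in neq_xy.
- by rewrite xc.
- by rewrite yc edge_sym.
have cN z : ball_graph D (ball_centre D) z -> ball_centre D != z.
  by apply: contraTneq => <-; rewrite edge_irr.
suff : 2 < #|ball_vertex D| by rewrite ltnNge leD2.
rewrite (leq_trans _ (max_card [set ball_centre D; x; y])) //.
by rewrite -setUA cardsU1 cards2 !inE negb_or !cN // neq_xy.
Qed.

Lemma ball_iso_small B C :
  #|ball_vertex B| <= 2 -> #|ball_vertex B| = #|ball_vertex C| -> ball_iso B C.
Proof.
move=> leB2 eqBC; have leC2 : #|ball_vertex C| <= 2 by rewrite -eqBC.
pose f0 x : ball_vertex C := enum_val (cast_ord eqBC (enum_rank x)).
(* Both balls are complete graphs, so any bijection preserves edges; the transposition corrects the
   image of the centre. *)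
pose f := tperm (f0 (ball_centre B)) (ball_centre C) \o f0.
have fI : injective f.
  by move=> x y /perm_inj/enum_val_inj/cast_ord_inj/enum_rank_inj.
exists f; split.
- by apply: inj_card_bij => //; rewrite eqBC.
- by move=> x y; rewrite !ball_graph_small // (inj_eq fI).
- by rewrite /f /= tpermL.
Qed.

(** * Edge edits *)

Section GraphEdits.
Variable V : finType.
Implicit Types (G H : sgraph V) (u v w x y : V) (A : {set V}).

Definition degree G v := #|neighbours G v|.

Lemma edit_distance_trans H G K :
  edit_distance G K <= edit_distance G H + edit_distance H K.
Proof.
have le (A B C : {set {set V}}) : #|A :\: C| <= #|A :\: B| + #|B :\: C|.
  apply: leq_trans (leq_card_setU _ _); apply/subset_leq_card/subsetP => e.
  by rewrite !inE; case: (e \in B); case: (e \in C); case: (e \in A).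
have := le (edges G) (edges H) (edges K).
by have := le (edges K) (edges H) (edges G); rewrite /edit_distance; lia.
Qed.

Lemma edit_distance_refl G : edit_distance G G = 0.
Proof. by rewrite /edit_distance setDv cards0. Qed.

Lemma edges_sub G H : (forall x y, G x y -> H x y) -> edges G \subset edges H.
Proof.
move=> sGH; apply/subsetP => e /imsetP[[x y]]; rewrite inE /= => /sGH Hxy ->.
by apply/imsetP; exists (x, y); rewrite ?inE.
Qed.

Section Delete.
Variables (G : sgraph V) (v : V) (A : {set V}).
Definition del_edge : rel V := fun x y =>
  G x y && ~~ ((x == v) && (y \in A) || (y == v) && (x \in A)).
Lemma del_edge_sym : symmetric del_edge.
Proof. by move=> x y; rewrite /del_edge edge_sym orbC. Qed.
Lemma del_edge_irr : irreflexive del_edge.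
Proof. by move=> x; rewrite /del_edge edge_irr. Qed.
Definition del_star := SGraph del_edge_sym del_edge_irr.

Lemma del_star_sub x y : del_star x y -> G x y.
Proof. by case/andP. Qed.

Lemma edit_distance_del_star : edit_distance G del_star <= #|A|.
Proof.
rewrite /edit_distance.
have /eqP-> : edges del_star :\: edges G == set0.
  by rewrite setD_eq0; apply: edges_sub del_star_sub.
rewrite cards0 addn0.
apply: leq_trans (leq_imset_card (fun x => [set v; x]) A).
apply/subset_leq_card/subsetP => e; rewrite inE => /andP[eN /imsetP[[x y]]].
rewrite inE /= => Gxy eE; apply/imsetP.
case: (boolP ((x == v) && (y \in A) || (y == v) && (x \in A))).
  case/orP=> /andP[/eqP xv yA]; [by exists y; rewrite // eE xv|].
  by exists x; rewrite // eE xv setUC.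
move=> N; case/imsetP: eN; exists (x, y) => //.
by rewrite inE /= /del_edge Gxy.
Qed.

Lemma neighbours_del_star w : A \subset neighbours G v ->
  neighbours del_star w =
    if w == v then neighbours G v :\: A
    else if w \in A then neighbours G w :\ v else neighbours G w.
Proof.
move=> sAN; apply/setP => x; rewrite inE /= /del_edge.
case: eqVneq => [->|wv] /=.
  rewrite !inE; case: (eqVneq x v) => [->|_] /=; rewrite ?edge_irr ?andbF //.
  by rewrite orbF andbC.
by case: (boolP (w \in A)) => wA; rewrite !inE ?andbT ?andbF ?andbT // andbC.
Qed.

Lemma degree_del_star w : A \subset neighbours G v ->
  degree del_star w = degree G w - (if w == v then #|A| else w \in A).
Proof.
move=> sAN; rewrite /degree neighbours_del_star //.
case: eqVneq => [->|wv]; first by rewrite cardsD (setIidPr sAN).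
case: (boolP (w \in A)) => wA; last by rewrite subn0.
have vw : v \in neighbours G w.
  by rewrite inE edge_sym; have := subsetP sAN _ wA; rewrite inE.
by rewrite (cardsD1 v (neighbours G w)) vw addKn.
Qed.

End Delete.

Section Add.
Variables (G : sgraph V) (u v : V) (uv : u != v).
Definition add_edge : rel V := fun x y =>
  [|| G x y, (x == u) && (y == v) | (x == v) && (y == u)].
Lemma add_edge_sym : symmetric add_edge.
Proof.
move=> x y; rewrite /add_edge edge_sym; case: (G y x) => //=.
by rewrite orbC; congr orb; rewrite andbC.
Qed.
Lemma add_edge_irr : irreflexive add_edge.
Proof.
move=> x; rewrite /add_edge edge_irr /=.
by case: eqVneq => [->|]; rewrite ?(negPf uv) //= andbF.
Qed.
Definition add_link := SGraph add_edge_sym add_edge_irr.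

Lemma edit_distance_add_link : edit_distance G add_link <= 1.
Proof.
rewrite /edit_distance.
have /eqP-> : edges G :\: edges add_link == set0.
  by rewrite setD_eq0; apply: edges_sub => x y /= Gxy; rewrite /add_edge Gxy.
rewrite cards0 add0n -(cards1 [set u; v]).
apply/subset_leq_card/subsetP => e; rewrite inE => /andP[eN /imsetP[[x y]]].
rewrite inE /= /add_edge.
case/or3P=> [Gxy|/andP[/eqP-> /eqP->]|/andP[/eqP-> /eqP->]] eE.
- by case/imsetP: eN; exists (x, y); rewrite ?inE.
- by rewrite eE inE.
- by rewrite eE setUC inE.
Qed.

Lemma neighbours_add_link w :
  neighbours add_link w =
    if w == u then v |: neighbours G w
    else if w == v then u |: neighbours G w else neighbours G w.
Proof.
apply/setP => x; rewrite inE /= /add_edge.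
case: (eqVneq w u) => [->|wu] /=.
  by rewrite (negPf uv) !inE orbF orbC.
by case: (eqVneq w v) => wv; rewrite !inE /= ?orbF // orbC.
Qed.

Lemma degree_add_link w : ~~ G u v ->
  degree add_link w = degree G w + ((w == u) || (w == v)).
Proof.
move=> nGuv; rewrite /degree neighbours_add_link.
case: eqVneq => [->|wu] /=; first by rewrite cardsU1 inE nGuv addnC.
case: eqVneq => [->|wv] /=; last by rewrite addn0.
by rewrite cardsU1 inE edge_sym nGuv addnC.
Qed.

End Add.

Lemma degree0 G v x : degree G v = 0 -> G v x = false.
Proof. by move=> /eqP; rewrite cards_eq0 => /eqP/setP/(_ x); rewrite !inE. Qed.

Lemma handshake G : ~~ odd (\sum_v degree G v).
Proof.
(* Ordering the vertices splits the degree sum into edges going up and edges going down, and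
   symmetry makes the two halves equal. *)
pose lt x y := enum_rank x < enum_rank y.
have E : \sum_v degree G v = \sum_v \sum_x (G v x : nat).
  by apply: eq_bigr => v _; rewrite /degree -sum1dep_card big_mkcond.
have {}E : \sum_v degree G v =
    (\sum_v \sum_(x | lt v x) (G v x : nat)) +
    (\sum_v \sum_(x | lt x v) (G v x : nat)).
  rewrite E -big_split; apply: eq_bigr => v _ /=.
  rewrite (bigID (lt v)) /=; congr addn.
  rewrite big_mkcond [RHS]big_mkcond; apply: eq_bigr => x _.
  rewrite -leqNgt /lt leq_eqVlt; case: ltngtP => //= /ord_inj/enum_rank_inj->.
  by rewrite edge_irr.
rewrite E [X in _ + X](exchange_big_dep predT) //=.
under [X in _ + X]eq_bigr => x _ do under eq_bigr => y _ do rewrite edge_sym.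
by rewrite addnn odd_double.
Qed.

End GraphEdits.

(** * Correcting a graph with few typed vertices *)

Section Correction.
Variables (B : ball1) (V : finType).
Implicit Types (G H : sgraph V) (u v w x y : V) (A : {set V}).

Notation k := (#|ball_vertex B|.-1).

Definition typed G : {set V} := [set v | `[< ball_iso B (nbhd_ball G v) >]].

Lemma typedP G v : reflect (ball_iso B (nbhd_ball G v)) (v \in typed G).
Proof. by rewrite inE; apply: asboolP. Qed.

Lemma typed_degree G v : v \in typed G -> degree G v = k.
Proof. by move=> /typedP/ball_iso_degree. Qed.

Lemma typed_small G v : k <= 1 -> (v \in typed G) = (degree G v == k).
Proof.
move=> k_le1; apply/idP/eqP => [/typed_degree//|degv]; apply/typedP.
have B_gt0 : 0 < #|ball_vertex B| by apply/card_gt0P; exists (ball_centre B).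
apply: ball_iso_small; first lia.
by rewrite card_nbhd_ball -/(degree G v) degv prednK.
Qed.

(** A ball is determined by the neighbours of its centre and the edges among them; the identity map
    is the isomorphism. *)
Lemma typed_local G H v :
    neighbours H v = neighbours G v ->
    {in neighbours G v &, forall x y, H x y = G x y} ->
  (v \in typed H) = (v \in typed G).
Proof.
suff imp G1 G2 : neighbours G2 v = neighbours G1 v ->
    {in neighbours G1 v &, forall x y, G2 x y = G1 x y} ->
    v \in typed G1 -> v \in typed G2.
  move=> NE HE; apply/idP/idP; apply: imp => // x y.
  by rewrite NE => *; rewrite HE.
move=> NE GE /typedP iG; apply/typedP/(ball_iso_trans iG).
apply: (@nbhd_ball_iso _ _ _ _ _ _ id) => //; rewrite ?NE //.
  by move=> x; rewrite /closed_nbhd NE.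
have GvE z : G2 v z = G1 v z by have /setP/(_ z) := NE; rewrite !inE.
move=> x y; rewrite !in_setU1 => /predU1P[->|xN] /predU1P[->|yN] //.
- by rewrite edge_sym GvE edge_sym.
- exact: GE.
Qed.

(* The point: a neighbour of a stubborn vertex cannot become typed as long as its
   degree does not change. *)
Definition stubborn G v := neighbours G v \subset [set x | degree G x == k.+1].

Lemma stubbornP G v x : stubborn G v -> G v x -> degree G x = k.+1.
Proof. by move=> /subsetP/(_ x); rewrite !inE => sv /sv/eqP. Qed.

(** Every deleted edge ends at [v], which lies outside the closed neighbourhood of [w]. *)
Lemma typed_del_star_out G v A w : w != v -> ~~ G v w ->
  A \subset neighbours G v -> (w \in typed (del_star G v A)) = (w \in typed G).
Proof.
move=> wv nGvw sAN.
have wA : w \notin A.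
  by apply: contra nGvw => /(subsetP sAN); rewrite inE.
apply: typed_local.
  by rewrite neighbours_del_star // (negPf wv) (negPf wA).
move=> x y; rewrite !inE => Gwx Gwy; rewrite /= /del_edge.
have nv z : G w z -> z == v = false.
  by move=> Gwz; apply: contraNF nGvw => /eqP<-; rewrite edge_sym.
by rewrite !nv //= andbT.
Qed.

Variable d : nat.

Lemma max_degree_del_star G v A :
  max_degree_le d G -> max_degree_le d (del_star G v A).
Proof.
move=> dG w; apply: leq_trans (dG w); apply/subset_leq_card/subsetP => x.
by rewrite !inE => /andP[].
Qed.

Lemma max_degree_add_link G u v (uv : u != v) : ~~ G u v ->
    max_degree_le d G -> degree G u < d -> degree G v < d ->
  max_degree_le d (add_link G uv).
Proof.
move=> nGuv dG du dv w; rewrite -/(degree _ w) degree_add_link //.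
case: eqVneq => [->|_] /=; first by rewrite addn1.
by case: eqVneq => [->|_] /=; rewrite ?addn1 // addn0; apply: dG.
Qed.

Lemma typed_del_nonstubborn G v A : v \in typed G -> ~~ stubborn G v ->
    A = neighbours G v :\: [set x | degree G x == k.+1] ->
  typed (del_star G v A) \subset typed G :\ v.
Proof.
move=> vT nsv AE; have A0 : A != set0 by rewrite AE setD_eq0.
have sAN : A \subset neighbours G v by rewrite AE subsetDl.
apply/subsetP => w wT; have degw := typed_degree wT.
rewrite degree_del_star // in degw.
have wv : w != v.
  apply/eqP => wv; move: degw; rewrite wv eqxx (typed_degree vT).
  have := subset_leq_card sAN; rewrite -/(degree G v) (typed_degree vT).
  by move: A0; rewrite -card_gt0; lia.
rewrite (negPf wv) in degw.
rewrite in_setD1 wv /=.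
have nGvw : ~~ G v w.
  apply/negP => Gvw; move: degw; rewrite AE !inE Gvw andbT.
  have : 0 < degree G w by apply/card_gt0P; exists v; rewrite inE edge_sym.
  by case: eqVneq => /=; lia.
by rewrite -(typed_del_star_out wv nGvw sAN).
Qed.

(** The condition on [u] keeps it from reaching degree [k]. It is applied with [u] typed, hence of
    degree [k], or with [u] isolated and [k >= 2]. *)
Lemma typed_add_link G v u (vu : v != u) : v \in typed G -> stubborn G v ->
    ~~ G v u -> (degree G u).+1 != k ->
  typed (add_link G vu) \subset typed G :\: [set v; u].
Proof.
move=> vT sv nGvu degu; apply/subsetP => w wT; have degw := typed_degree wT.
rewrite degree_add_link // in degw.
have wv : w != v.
  by apply/eqP => wv; move: degw; rewrite wv eqxx (typed_degree vT) /=; lia.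
have wu : w != u.
  by apply: contraNneq degu => wu; rewrite -degw wu eqxx orbT addn1.
rewrite (negPf wv) (negPf wu) addn0 in degw.
rewrite in_setD !inE negb_or wv wu /=.
have nGwv : ~~ G v w by apply/negP => /(stubbornP sv); rewrite degw; lia.
have := wT; rewrite (@typed_local G) ?inE //.
  by rewrite neighbours_add_link (negPf wv) (negPf wu).
move=> x y; rewrite !inE => Gwx Gwy; rewrite /= /add_edge.
have nv z : G w z -> z == v = false.
  by move=> Gwz; apply: contraNF nGwv => /eqP<-; rewrite edge_sym.
by rewrite !nv //= !andbF !orbF.
Qed.

(** * Elimination of all typed vertices *)

Hypothesis kd : k = 0 -> 0 < d.

(** This leaves room for one more edge at [v]. A neighbour of [v] witnesses that degree [k + 1] is
    allowed; for [k = 0] there is no neighbour and [kd] takes over. *)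
Lemma stubborn_degree G v : max_degree_le d G -> v \in typed G ->
  stubborn G v -> k < d.
Proof.
move=> dG vT sv; case: (posnP k) => [k0|k_gt0]; first by rewrite k0 kd.
have /card_gt0P[x] : 0 < #|neighbours G v|.
  by rewrite -/(degree G v) (typed_degree vT).
by rewrite inE => /(stubbornP sv) <-; apply: dG.
Qed.

(** Each round costs at most [k + 1] edits and lowers the number of typed vertices. The last clause,
    that isolated vertices stay isolated, serves [fix_stubborn_ge2]. *)
Lemma reduce_typed m G : #|typed G| <= m -> max_degree_le d G ->
  exists H, [/\ max_degree_le d H, edit_distance G H <= k.+1 * m,
    typed H = set0 \/ exists v, [/\ typed H = [set v] & stubborn H v]
  & forall w, 0 < k -> degree G w = 0 -> degree H w = 0].
Proof.
elim: m G => [|m IHm] G; first rewrite leqn0 cards_eq0 => /eqP T0 dG.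
  by exists G; split; rewrite ?edit_distance_refl //; left.
move=> Tm dG.
have step H1 : max_degree_le d H1 -> edit_distance G H1 <= k.+1 ->
    #|typed H1| <= m -> (forall w, 0 < k -> degree G w = 0 -> degree H1 w = 0) ->
  exists H, [/\ max_degree_le d H, edit_distance G H <= k.+1 * m.+1,
    typed H = set0 \/ exists v, [/\ typed H = [set v] & stubborn H v]
  & forall w, 0 < k -> degree G w = 0 -> degree H w = 0].
  move=> dH1 eH1 TH1 iH1; have [H [dH eH TH iH]] := IHm _ TH1 dH1.
  exists H; split=> // [|w k_gt0 /(iH1 _ k_gt0)]; last exact: iH.
  by have := edit_distance_trans H1 G H; lia.
have [v /andP[vT nsv]|stub] :=
  pickP [pred v | (v \in typed G) && ~~ stubborn G v].
  pose A := neighbours G v :\: [set x | degree G x == k.+1].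
  have sAN : A \subset neighbours G v by apply: subsetDl.
  apply: (step (del_star G v A)).
  - exact: max_degree_del_star.
  - apply: leq_trans (edit_distance_del_star _ _ _) _.
    by rewrite -(typed_degree vT); apply/leqW/subset_leq_card.
  - have := subset_leq_card (typed_del_nonstubborn vT nsv (erefl A)).
    by have := cardsD1 v (typed G); rewrite vT; lia.
  - by move=> w _ w0; rewrite degree_del_star // w0.
have {}stub v : v \in typed G -> stubborn G v.
  by move=> vT; apply: contraFT (stub v) => nsv /=; rewrite vT.
have [T_le1|] := leqP #|typed G| 1.
  exists G; rewrite edit_distance_refl; split=> //.
  case: (set_0Vmem (typed G)) => [|[v vT]]; [by left|right; exists v].
  split; last exact: stub.
  by apply/esym/eqP; rewrite eqEcard sub1set vT cards1.
case/card_gt1P => v [u [vT uT vu]].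
have nGvu : ~~ G v u.
  by apply/negP => /(stubbornP (stub _ vT)); rewrite (typed_degree uT); lia.
have k_lt_d := stubborn_degree dG vT (stub _ vT).
apply: (step (add_link G vu)).
- by apply: max_degree_add_link; rewrite // (typed_degree, typed_degree).
- by apply: leq_trans (edit_distance_add_link _ _) _.
- have degu : (degree G u).+1 != k by rewrite (typed_degree uT); lia.
  have := subset_leq_card (typed_add_link vu vT (stub _ vT) nGvu degu).
  have := subset_leq_card (setDS (typed G) (subsetUl [set v] [set u])).
  by have := cardsD1 v (typed G); rewrite vT; lia.
- move=> w k_gt0 w0; rewrite degree_add_link // w0.
  by case: eqVneq => [wv|_]; [|case: eqVneq => [wu|//]]; move: w0;
    rewrite ?wv ?wu typed_degree //; lia.
Qed.

(** The budget splits into [k] deletions at [v], [(k + 1) * k] edits for the second reduction and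
    one final insertion. *)
Lemma fix_stubborn_ge2 G v : 1 < k -> max_degree_le d G ->
    typed G = [set v] -> stubborn G v ->
  exists H, [/\ max_degree_le d H, typed H = set0
    & edit_distance G H <= k.+1 * k.+1].
Proof.
move=> k_gt1 dG TG sv; have vT : v \in typed G by rewrite TG set11.
have k_lt_d := stubborn_degree dG vT sv.
pose A := neighbours G v; pose G1 := del_star G v A.
have dG1 : max_degree_le d G1 by apply: max_degree_del_star.
have eG1 : edit_distance G G1 <= k.
  by rewrite -(typed_degree vT); apply: edit_distance_del_star.
have v0 : degree G1 v = 0 by rewrite degree_del_star // eqxx subnn.
(* Only former neighbours of [v] can have become typed, since all non-neighbours keep their type and
   [v] was the only typed vertex. *)
have TG1 : #|typed G1| <= k.
  rewrite -(typed_degree vT); apply/subset_leq_card/subsetP => w wT.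
  have wv : w != v.
    by apply/eqP => wv; have := typed_degree wT; rewrite wv v0; lia.
  rewrite inE; apply: contraLR wT => nGvw.
  by rewrite typed_del_star_out // TG inE.
have [H [dH eH TH iH]] := reduce_typed TG1 dG1.
have eGH := edit_distance_trans G1 G H.
case: TH => [TH|[x [TH sx]]]; first by exists H; split=> //; nia.
have xT : x \in typed H by rewrite TH set11.
have Hv0 : degree H v = 0 by apply: iH => //; lia.
have xv : x != v.
  by apply/eqP => xv; have := typed_degree xT; rewrite xv Hv0; lia.
have nHxv : ~~ H x v by rewrite edge_sym degree0.
exists (add_link H xv); split.
- apply: max_degree_add_link => //; first by rewrite typed_degree.
  by rewrite Hv0; lia.
- have degv : (degree H v).+1 != k by rewrite Hv0; lia.
  apply/eqP; rewrite -subset0.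
  apply: subset_trans (typed_add_link xv xT sx nHxv degv) _.
  rewrite TH; apply/subsetP => w; rewrite !inE.
  by case: eqP => //= _; rewrite andbF.
- have := edit_distance_trans H G (add_link H xv).
  by have := edit_distance_add_link H xv; nia.
Qed.

Lemma fix_stubborn_1 G v : k = 1 -> max_degree_le d G ->
    typed G = [set v] -> stubborn G v ->
  exists H, [/\ max_degree_le d H, typed H = set0 & edit_distance G H <= 2].
Proof.
move=> k1 dG TG sv; have vT : v \in typed G by rewrite TG set11.
have k_lt_d := stubborn_degree dG vT sv.
have deg1 w : w != v -> degree G w != 1.
  by move=> wv; rewrite -k1 -typed_small ?k1 // TG inE.
have degv : degree G v = 1 by rewrite typed_degree.
(* The degree of [v] is 1, so by parity another vertex has odd degree; that degree is not 1, hence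
   at least 3. *)
have [y /andP[yv oddy]] : exists y, (y != v) && odd (degree G y).
  apply/existsP; apply: contraNT (handshake G) => /existsPn noy.
  rewrite (bigD1 v) //= oddD degv /=.
  elim/big_ind: _ => //= [a b|y yv]; first by rewrite oddD => /negPf-> .
  by have := noy y; rewrite yv.
have degy : 2 < degree G y.
  by have := deg1 _ yv; case: (degree G y) oddy => [|[|[]]].
have nGvy : ~~ G v y by apply/negP => /(stubbornP sv); lia.
(* [y] has more neighbours than [v], so some edge at [y] can be moved to [v] without creating a
   double edge. *)
have [z /andP[Gyz nGvz]] : exists z, G y z && ~~ G v z.
  apply/existsP; apply: contraTT degy => /existsPn noz; rewrite -leqNgt.
  apply: (@leq_trans (degree G v)); last by rewrite degv.
  apply/subset_leq_card/subsetP => z; rewrite !inE => Gyz.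
  by have := noz z; rewrite Gyz negbK.
have zv : z != v by apply: contraNneq nGvy => <-; rewrite edge_sym.
have vz : v != z by rewrite eq_sym.
have yz : y != z by apply: contraTneq Gyz => ->; rewrite edge_irr.
pose G1 := del_star G y [set z].
have sN : [set z] \subset neighbours G y by rewrite sub1set inE.
have nG1 : ~~ G1 v z by apply: contra nGvz => /del_star_sub.
have degG1 w : degree G1 w = degree G w - ((w == y) || (w == z)).
  rewrite degree_del_star // cards1 inE; by case: (w == y).
have degz : degree G z != 0.
  by rewrite -lt0n; apply/card_gt0P; exists y; rewrite inE edge_sym.
(* [z] regains the edge it lost, so only [v] and [y] change degree, and both end with degree at
   least 2. *)
have degH w : degree (add_link G1 vz) w =
    if w == v then 2 else if w == y then (degree G y).-1 else degree G w.
  rewrite degree_add_link // degG1; case: (eqVneq w v) => [->|wv].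
    by rewrite (negPf vz) eq_sym (negPf yv) degv.
  case: (eqVneq w y) => [->|wy] /=; first by rewrite (negPf yz) addn0 subn1.
  by case: eqVneq => [->|_] /=; rewrite ?subn0 ?addn0 // subnK // lt0n.
exists (add_link G1 vz); split.
- move=> w; rewrite -/(degree _ w) degH; case: eqP => _; first by rewrite -k1.
  by case: eqP => _; [apply: leq_trans (leq_pred _) (dG y)|exact: dG].
- apply/eqP; rewrite -subset0; apply/subsetP => w /typed_degree.
  rewrite degH k1; case: eqP => // /eqP/deg1 /eqP w1; case: eqP => // _ y2.
  by move: degy; rewrite -ltn_predRL y2.
- apply: leq_trans (edit_distance_trans G1 _ _) _.
  rewrite -[2]/(1 + 1) leq_add ?edit_distance_add_link //.
  by rewrite (leq_trans (edit_distance_del_star _ _ _)) ?cards1.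
Qed.

Lemma fix_stubborn_0 G v : k = 0 -> max_degree_le d G -> typed G = [set v] ->
    #|V| != 1 -> (d = 1 -> ~~ odd #|V|) ->
  exists H, [/\ max_degree_le d H, typed H = set0 & edit_distance G H <= 3].
Proof.
move=> k0 dG TG V1 dV; have vT : v \in typed G by rewrite TG set11.
have deg0 w : w != v -> degree G w != 0.
  by move=> wv; rewrite -k0 -typed_small ?k0 // TG inE.
have degv : degree G v = 0 by rewrite typed_degree.
have V_gt0 : 0 < #|V| by apply/card_gt0P; exists v.
(* If [d = 1], every vertex other than [v] has degree exactly 1, so [#|V| - 1] is even, against the
   parity hypothesis. *)
have d_gt1 : 1 < d.
  have := kd k0; case: (eqVneq d 1) => [d1 _|]; last lia.
  have := handshake G; rewrite (bigD1 v) //= degv add0n.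
  rewrite (eq_bigr (fun=> 1)) => [|w /deg0 w0]; last first.
    by have := dG w; rewrite d1 -/(degree G w); lia.
  rewrite sum1_card; have -> : #|[pred w | w != v]| = #|V|.-1.
    by rewrite -(cardC1 v); apply: eq_card.
  by have := dV d1; lia.
have [y yv] : exists y, y != v.
  have /card_gt1P[y [z [_ _ yz]]] : 1 < #|V| by lia.
  by case: (eqVneq y v) => [yv|]; [exists z; rewrite -yv eq_sym|exists y].
have [z Gyz] : exists z, G y z.
  have /card_gt0P[z] : 0 < degree G y by rewrite lt0n deg0.
  by rewrite inE; exists z.
have vz : v != z by apply: contraTneq Gyz => <-; rewrite edge_sym degree0.
have yz : y != z by apply: contraTneq Gyz => ->; rewrite edge_irr.
have vy : v != y by rewrite eq_sym.
pose G1 := del_star G y [set z].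
have sN : [set z] \subset neighbours G y by rewrite sub1set inE.
have degG1 w : degree G1 w = degree G w - ((w == y) || (w == z)).
  by rewrite degree_del_star // cards1 inE; case: (w == y).
have nG1 w : ~~ G1 v w by rewrite degree0 // degG1 degv.
pose G2 := add_link G1 vz.
have nG2 : ~~ G2 v y.
  by rewrite /= /add_edge (negPf (nG1 y)) (negPf yz) (negPf vz) /= andbF.
have degz : degree G z != 0 by rewrite deg0 // eq_sym.
have degy := deg0 _ yv.
(* Replacing the edge [yz] by the path through [v] preserves the degrees of [y] and [z]. *)
have degH w : degree (add_link G2 vy) w = if w == v then 2 else degree G w.
  rewrite degree_add_link // degree_add_link // degG1.
  case: (eqVneq w v) => [->|wv]; first by rewrite degv.
  case: (eqVneq w y) => [->|wy] /=.
    by rewrite (negPf yz) addn0 subnK // lt0n.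
  by case: eqVneq => [->|_] /=; rewrite ?subn0 ?addn0 // subnK // lt0n.
exists (add_link G2 vy); split.
- by move=> w; rewrite -/(degree _ w) degH; have := dG w; case: eqP.
- apply/eqP; rewrite -subset0; apply/subsetP => w /typed_degree.
  by rewrite degH k0; case: eqP => // /eqP/deg0/eqP.
- apply: leq_trans (edit_distance_trans G2 _ _) _.
  rewrite -[3]/(2 + 1) leq_add ?edit_distance_add_link //.
  apply: leq_trans (edit_distance_trans G1 _ _) _.
  rewrite -[2]/(1 + 1) leq_add ?edit_distance_add_link //.
  by rewrite (leq_trans (edit_distance_del_star _ _ _)) ?cards1.
Qed.

(** The first summand pays the reduction, per typed vertex. The rest pays the final repair, done at
    most once; the [+ 2] makes room for the 3 edits needed when [k = 0]. *)
Definition correction_cost := k.+1 + (k.+1 * k.+1 + 2).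

Lemma correct_typed G : max_degree_le d G ->
    (k = 0 -> #|V| != 1 /\ (d = 1 -> ~~ odd #|V|)) ->
  exists H, [/\ max_degree_le d H, typed H = set0
    & edit_distance G H <= correction_cost * #|typed G|].
Proof.
move=> dG k0V; case: (posnP #|typed G|) => [/eqP|T_gt0].
  rewrite cards_eq0 => /eqP T0.
  by exists G; split; rewrite // edit_distance_refl.
have [G1 [dG1 eG1 TG1 _]] := reduce_typed (leqnn _) dG.
have [H [dH TH eH]] : exists H, [/\ max_degree_le d H, typed H = set0
    & edit_distance G1 H <= k.+1 * k.+1 + 2].
  case: TG1 => [TG1|[v [TG1 sv]]].
    by exists G1; split; rewrite // edit_distance_refl.
  case: (ltnP 1 k) => [k_gt1|k_le1].
    have [H [dH TH eH]] := fix_stubborn_ge2 k_gt1 dG1 TG1 sv.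
    by exists H; split=> //; lia.
  case: (posnP k) => [k0|k_gt0].
    have [V1 dV] := k0V k0.
    have [H [dH TH eH]] := fix_stubborn_0 k0 dG1 TG1 V1 dV.
    by exists H; split=> //; lia.
  have k1 : k = 1 by lia.
  have [H [dH TH eH]] := fix_stubborn_1 k1 dG1 TG1 sv.
  by exists H; split=> //; lia.
exists H; split=> //; have := edit_distance_trans G1 G H.
by rewrite /correction_cost; nia.
Qed.

End Correction.

(** * Execution of programs *)

Section Execution.
Variables (R : realType) (eps : R) (query : nat -> nat -> nat).

(** Worst-case halting and the output probability are carried together, so that one pass through the
    program yields both. *)
Definition good_run b T (rho : R) s :=
  halts_within eps query T s /\ (rho <= prob_output eps query b T s)%R.

(** Spare time changes nothing after halting; hence all time bounds below may be generous. *)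
Lemma halts_within_leq T T' s : T <= T' -> halts_within eps query T s ->
  halts_within eps query T' s /\
  forall b, prob_output eps query b T' s = prob_output eps query b T s.
Proof.
elim: T T' s => [|T IHT] [|T'] [[|c k] m] // leT /= haltT.
split=> [|b].
  by apply: sub_all haltT => s /(IHT T' s leT)[].
congr (_ / _)%R; elim: (step _ _ _ _ _) haltT => [_|s l IHl /andP[hs hl]].
  by rewrite !big_nil.
by rewrite !big_cons IHl //; have [_ ->] := IHT T' s leT hs.
Qed.

Lemma good_run_leq b T T' rho s : T <= T' -> good_run b T rho s ->
  good_run b T' rho s.
Proof. by move=> leT [/(halts_within_leq leT)[hs ps] ?]; split; rewrite ?ps. Qed.

Lemma good_run_step b T rho c k m s : step eps query c k m = [:: s] ->
  good_run b T rho s -> good_run b T.+1 rho (c :: k, m).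
Proof.
by move=> E [hs ps]; split; rewrite /= E /= ?hs // big_seq1 divr1.
Qed.

Lemma good_run_rand b T (rho : nat -> R) a e k m n : eval m e = n.+1 ->
    (forall x, x < n.+1 ->
      good_run b T (rho x) (k, update m (eval m a) x)) ->
  good_run b T.+1 ((\sum_(x < n.+1) rho x) / n.+1%:R)%R (Rand a e :: k, m).
Proof.
move=> en gx; split; rewrite /= en.
  by rewrite all_map; apply/allP => x; rewrite mem_iota => /gx[].
rewrite size_map size_iota ler_pM2r ?invr_gt0 ?ltr0n // big_map.
rewrite -[iota 0 n.+1]/(index_iota 0 n.+1) big_mkord.
by apply: ler_sum => x _; case: (gx x (ltn_ord x)).
Qed.

(** * Straight-line code that reads off a 1-ball *)

Fixpoint straight (c : cmd) : bool :=
  match c with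
  | Rand _ _ | While _ _ => false
  | Seq c1 c2 | If _ c1 c2 => straight c1 && straight c2
  | _ => true
  end.

Fixpoint exec (c : cmd) (m : memory) : memory :=
  match c with
  | Store a e => update m (eval m a) (eval m e)
  | Query a v i => update m (eval m a) (query (eval m v) (eval m i))
  | CmpEps a x y => update m (eval m a)
                      (eps * (eval m x)%:R <= (eval m y)%:R :> R)%R
  | Seq c1 c2 => exec c2 (exec c1 m)
  | If e c1 c2 => if eval m e != 0 then exec c1 m else exec c2 m
  | _ => m
  end.

Fixpoint cost (c : cmd) : nat :=
  match c with
  | Seq c1 c2 | If _ c1 c2 => (cost c1 + cost c2).+1
  | _ => 1
  end.

Lemma good_run_straight b T rho c k m : straight c ->
  good_run b T rho (k, exec c m) -> good_run b (cost c + T) rho (c :: k, m).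
Proof.
elim: c T k m => [a e|//|a v i|a x y|c1 IH1 c2 IH2|e c1 IH1 c2 IH2|//] T k m /=.
- by move=> _; apply: good_run_step.
- by move=> _; apply: good_run_step.
- by move=> _; apply: good_run_step.
- case/andP=> s1 s2 g; rewrite addSn -addnA; apply: good_run_step => //.
  exact/IH1/IH2.
- case/andP=> s1 s2 g; rewrite addSn; apply: good_run_step => //.
  case: ifP g => _ g.
    by apply: good_run_leq (IH1 _ _ _ s1 g); rewrite leq_add2r leq_addr.
  by apply: good_run_leq (IH2 _ _ _ s2 g); rewrite leq_add2r leq_addl.
Qed.

Lemma straight_seq c1 c2 : straight (Seq c1 c2) = straight c1 && straight c2.
Proof. by []. Qed.

Lemma exec_seq c1 c2 m : exec (Seq c1 c2) m = exec c2 (exec c1 m).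
Proof. by []. Qed.

(* Cell 0 is the output, cell 1 holds n, cell 2 counts samples, cell 3 is
   scratch, cell 4 holds the sampled vertex, and the cells from 5 on hold the
   slots. *)
Definition skip := Store (Const 3) (Const 0).

(** A decision tree: the truth values of [es] are handed to the function [f] that builds the
    program. So an arbitrary Boolean function of finitely many bits can be hard-wired. *)
Fixpoint branch (es : seq expr) (f : seq bool -> cmd) : cmd :=
  if es is e :: es' then
    If e (branch es' (fun bs => f (true :: bs)))
         (branch es' (fun bs => f (false :: bs)))
  else f [::].

Lemma straight_branch es f : (forall bs, straight (f bs)) ->
  straight (branch es f).
Proof. by elim: es f => //= e es IH f sf; rewrite !IH. Qed.

Lemma exec_branch es f m :
  exec (branch es f) m = exec (f [seq eval m e != 0 | e <- es]) m.
Proof. by elim: es f => //= e es IH f; rewrite !IH; case: (eval m e != 0). Qed.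

(* Slot 0 encodes v itself and slot i + 1 its i-th neighbour; as in oracle
   answers, a vertex u is encoded by u + 1 and its absence by 0. *)
Definition slot v j := if j is i.+1 then query v i else v.+1.

Variable d : nat.

Definition slots := iota 0 d.+1.

Lemma mem_slots j : (j \in slots) = (j <= d).
Proof. by rewrite mem_iota. Qed.

(** First the occupied slots; then, for each slot [i] and index [l], a row telling from which slots
    the [l]-th neighbour of slot [i] differs. This records the ball up to isomorphism in a number of
    bits depending on [d] only. For an empty slot the subtraction truncates and vertex 0 is
    queried. *)
Definition pattern v : seq bool * seq (seq bool) :=
  ([seq slot v j != 0 | j <- slots],
   [seq [seq query (slot v p.1 - 1) p.2 != slot v j | j <- slots]
     | p <- [seq (i, l) | i <- slots, l <- iota 0 d]]).

Definition slot_cell j := Cell (Const (5 + j)).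

(** The absolute difference, as one of the truncated subtractions is always 0. *)
Definition neq_expr e1 e2 := Plus (Minus e1 e2) (Minus e2 e1).

Lemma eval_neq m e1 e2 :
  (eval m (neq_expr e1 e2) != 0) = (eval m e1 != eval m e2).
Proof. by rewrite /=; lia. Qed.

Fixpoint fill i : cmd :=
  if i is i'.+1 then
    Seq (fill i') (Query (Const (5 + i)) (Cell (Const 4)) (Const i'))
  else Store (Const 5) (Plus (Cell (Const 4)) (Const 1)).

Fixpoint collect (J : seq nat) (L : seq (nat * nat))
    (f : seq (seq bool) -> cmd) : cmd :=
  if L is p :: L' then
    Seq (Query (Const 3) (Minus (slot_cell p.1) (Const 1)) (Const p.2))
      (branch [seq neq_expr (Cell (Const 3)) (slot_cell j) | j <- J]
        (fun bs => collect J L' (fun bbs => f (bs :: bbs))))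
  else f [::].

Definition inspect (f : seq bool * seq (seq bool) -> bool) : cmd :=
  Seq (fill d)
    (branch [seq slot_cell j | j <- slots]
      (fun bs => collect slots [seq (i, l) | i <- slots, l <- iota 0 d]
        (fun bbs => if f (bs, bbs) then Store (Const 0) (Const 0) else skip))).

Lemma exec_fill i m :
  (forall j, j <= i -> exec (fill i) m (5 + j) = slot (m 4) j) /\
  (forall a, a < 5 -> exec (fill i) m a = m a).
Proof.
elim: i => [|i [IHs IHm]]; split.
- by case=> // _; rewrite /= /update /= addn1.
- by move=> a; rewrite /= /update; case: eqP => // ->.
- move=> j; rewrite leq_eqVlt => /predU1P[->|ltj]; rewrite /= /update.
    by rewrite eqxx IHm.
  by rewrite (_ : _ == _ = false) ?IHs //; lia.
- by move=> a lta; rewrite /= /update ltn_eqF ?IHm //; apply: leq_trans lta _.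
Qed.

(** The queries overwrite scratch cell 3, so the final memory is described only outside that
    cell. *)
Lemma exec_collect v J L f m :
  (forall j, j <= d -> m (5 + j) = slot v j) ->
  {in J, forall j, j <= d} -> all (fun p => p.1 <= d) L ->
  exists m', (forall a, a != 3 -> m' a = m a) /\
    exec (collect J L f) m =
    exec (f [seq [seq query (slot v p.1 - 1) p.2 != slot v j | j <- J]
              | p <- L]) m'.
Proof.
move=> + leJ; elim: L f m => [|p L IHL] f m mE; first by exists m.
case/andP=> lep leL /=; rewrite exec_branch.
set m1 := update _ _ _.
have m1E a : a != 3 -> m1 a = m a by rewrite /m1 /update => /negPf->.
have m1s j : j <= d -> m1 (5 + j) = slot v j by move=> lej; rewrite m1E ?mE.
set bs := [seq eval m1 e != 0 | e <- _].
have [m' [m'E ->]] := IHL (fun bbs => f (bs :: bbs)) m1 m1s leL.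
exists m'; split=> [a a3|]; first by rewrite m'E ?m1E.
congr (exec (f (_ :: _)) _); rewrite /bs -map_comp; apply/eq_in_map => j.
move=> /leJ lej; rewrite [LHS]eval_neq /= (m1s j lej).
by rewrite /m1 /update eqxx /= (mE _ lep).
Qed.

Lemma straight_inspect f : straight (inspect f).
Proof.
have straight_fill i : straight (fill i) by elim: i => //= i ->.
have straight_collect J L g : (forall bbs, straight (g bbs)) ->
    straight (collect J L g).
  by elim: L g => //= p L IHL g sg; apply: straight_branch => bs; apply: IHL.
rewrite /inspect straight_seq straight_fill straight_branch // => bs.
by apply: straight_collect => bbs; case: ifP.
Qed.

Lemma exec_inspect f m :
  [/\ exec (inspect f) m 0 = if f (pattern (m 4)) then 0 else m 0,
      exec (inspect f) m 1 = m 1 & exec (inspect f) m 2 = m 2].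
Proof.
have [fs fm] := exec_fill d m.
rewrite /inspect exec_seq exec_branch.
have leJ : {in slots, forall j, j <= d} by move=> j; rewrite mem_slots.
have leL : all (fun p => p.1 <= d) [seq (i, l) | i <- slots, l <- iota 0 d].
  by apply/allP => _ /allpairsP[[i l] [/= + _ ->]]; rewrite mem_slots.
have -> : [seq eval (exec (fill d) m) e != 0
            | e <- [seq slot_cell j | j <- slots]] = (pattern (m 4)).1.
  rewrite -map_comp; apply/eq_in_map => j; rewrite mem_slots => lej.
  by rewrite -(fs j lej).
have [m' [m'E ->]] := exec_collect (fun bbs => if f ((pattern (m 4)).1, bbs)
  then Store (Const 0) (Const 0) else skip) fs leJ leL.
by case: ifP => _; split; rewrite /= /update /= ?m'E ?fm.
Qed.

End Execution.

(** * Adjacency lists, oracle answers and patterns *)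

Section ClosedList.
Variables (n d : nat) (G : sgraph 'I_n) (adj : 'I_n -> seq 'I_n).
Hypotheses (dG : max_degree_le d G) (adjG : adjacency_lists G adj).

Lemma size_adj v : size (adj v) = degree G v.
Proof.
have [uv vE] := adjG v.
by rewrite -(card_uniqP uv) /degree; apply: eq_card => x; rewrite vE.
Qed.

Lemma oracle_adj (v : 'I_n) i x0 :
  oracle adj v i = if i < size (adj v) then (nth x0 (adj v) i).+1 else 0.
Proof.
rewrite /oracle valK; case: ltnP => [lti|]; last by move=> /onth_default->.
by rewrite onthE (nth_map x0).
Qed.

Lemma oracle_eq_adj (u w : 'I_n) :
  has (fun l => oracle adj u l == w.+1) (iota 0 d) = G u w.
Proof.
have [_ uE] := adjG u; have <- : (w \in adj u) = G u w by rewrite uE inE.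
apply/hasP/idP => [[l _]|wu].
  rewrite (oracle_adj u l u); case: ltnP => // ltl /eqP[/ord_inj<-].
  exact: mem_nth.
exists (index w (adj u)); last first.
  by rewrite (oracle_adj u _ u) index_mem wu nth_index.
by rewrite mem_iota /= (leq_trans _ (dG u)) // -/(degree G u) -size_adj index_mem.
Qed.

Definition closed_list v := v :: adj v.

Lemma closed_list_uniq v : uniq (closed_list v).
Proof. by have [uv vE] := adjG v; rewrite /= uv vE inE edge_irr. Qed.

Lemma mem_closed_list v x : (x \in closed_list v) = (x \in closed_nbhd G v).
Proof. by have [_ vE] := adjG v; rewrite !inE vE inE. Qed.

Lemma size_closed_list v : size (closed_list v) = (degree G v).+1.
Proof. by rewrite /= size_adj. Qed.

Lemma slot_oracle (v : 'I_n) j x0 : slot (oracle adj) v j =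
  if j < size (closed_list v) then (nth x0 (closed_list v) j).+1 else 0.
Proof. by case: j => //= j; rewrite (oracle_adj v j x0). Qed.

End ClosedList.

(** The isomorphism matches equal positions in the two closed lists; position 0 holds the
    centres. *)
Lemma pattern_iso d n n' (G : sgraph 'I_n) (G' : sgraph 'I_n') adj adj'
    (v : 'I_n) (v' : 'I_n') :
    max_degree_le d G -> max_degree_le d G' ->
    adjacency_lists G adj -> adjacency_lists G' adj' ->
    pattern (oracle adj) d v = pattern (oracle adj') d v' ->
  ball_iso (nbhd_ball G v) (nbhd_ball G' v').
Proof.
move=> dG dG' adjG adjG' eq_pat.
have /eq_in_map nz_eq := congr1 fst eq_pat.
have /eq_in_map adj_eq := congr1 snd eq_pat.
have sE := size_closed_list adjG v; have sE' := size_closed_list adjG' v'.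
have nz j : j <= d -> (j < size (closed_list adj v)) =
                      (j < size (closed_list adj' v')).
  move=> lej; have := nz_eq j; rewrite mem_slots => /(_ lej).
  by rewrite (slot_oracle _ _ _ v) (slot_oracle _ _ _ v'); do 2!case: ifP.
(* If the sizes differed, the smaller one would be a slot index at most [d] that is occupied on one
   side only. *)
have size_eq : size (closed_list adj v) = size (closed_list adj' v').
  have := dG v; have := dG' v'; rewrite -!/(degree _ _) => ? ?.
  case: (ltngtP (size (closed_list adj v)) (size (closed_list adj' v'))) => // lt.
    by have := nz (size (closed_list adj v)); rewrite ltnn lt; lia.
  by have := nz (size (closed_list adj' v')); rewrite ltnn lt; lia.
set s := closed_list adj v in sE nz size_eq *.
set s' := closed_list adj' v' in sE' nz size_eq *.
have s_uniq : uniq s := closed_list_uniq adjG v.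
have s'_uniq : uniq s' := closed_list_uniq adjG' v'.
have ltd i : i < size s -> i <= d.
  by rewrite sE ltnS => /leq_trans; apply; apply: dG.
(* Adjacency of positions [i] and [j] means that some row [(i, l)] of the pattern reports a match
   with slot [j]. *)
have edge_eq i j : i < size s -> j < size s ->
    G' (nth v' s' i) (nth v' s' j) = G (nth v s i) (nth v s j).
  move=> lti ltj.
  rewrite -(oracle_eq_adj dG adjG) -(oracle_eq_adj dG' adjG').
  apply: eq_in_has => l; rewrite mem_iota /= => ltl.
  have /adj_eq/eq_in_map/(_ j) :
      (i, l) \in [seq (i, l) | i <- slots d, l <- iota 0 d].
    by apply/allpairsP; exists (i, l); rewrite mem_slots mem_iota ltd.
  rewrite mem_slots => /(_ (ltd _ ltj)) /=.
  rewrite !(slot_oracle _ _ _ v) !(slot_oracle _ _ _ v') -/s -/s' -size_eq lti ltj.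
  by rewrite !subn1 /= => /negb_inj->.
apply: (@nbhd_ball_iso _ _ _ _ _ _ (fun x => nth v' s' (index x s))).
- by rewrite /= eqxx.
- move=> x; rewrite -(mem_closed_list adjG) -(mem_closed_list adjG') => xs.
  by rewrite mem_nth // -size_eq index_mem.
- move=> x y; rewrite -!(mem_closed_list adjG) => xs ys /eqP.
  rewrite nth_uniq // -?size_eq ?index_mem // => /eqP E.
  by rewrite -(nth_index v xs) -(nth_index v ys) E.
- by rewrite -!/(degree _ _) -ltnS -sE -sE' size_eq.
- move=> x y; rewrite -!(mem_closed_list adjG) => xs ys.
  by rewrite edge_eq ?index_mem // !nth_index.
Qed.

(** * The tester *)

Section Tester.

(** These are the [n] for which no graph of maximum degree at most [d] avoids the type: for [k = 0]
    such a graph would have no isolated vertex. *)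
Definition infeasible (k d n : nat) : bool :=
  (k == 0) && (if d == 0 then n != 0 else if d == 1 then odd n else n == 1).

Definition infeasible_expr (k d : nat) : expr :=
  let n := Cell (Const 1) in
  if k == 0 then
    if d == 0 then n
    else if d == 1 then Minus n (Plus (Half n) (Half n))
    else Minus (Const 1) (neq_expr n (Const 1))
  else Const 0.

Lemma eval_infeasible k d m :
  (eval m (infeasible_expr k d) != 0) = infeasible k d (m 1).
Proof.
rewrite /infeasible_expr /infeasible; case: (k == 0) => //=.
case: (d == 0) => //; case: (d == 1) => /=; last by lia.
by rewrite addnn -{1}(odd_double_half (m 1)) addnK; case: odd.
Qed.

(** Since [eps] is open to comparisons only, the number of samples is found by search: cell 2 ends
    with the least [s] such that [K < eps * s]. *)
Definition counting (K : nat) : cmd :=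
  While (Cell (Const 3))
    (Seq (Store (Const 2) (Plus (Cell (Const 2)) (Const 1)))
         (CmpEps (Const 3) (Cell (Const 2)) (Const K))).

Definition sampling (d : nat) (f : seq bool * seq (seq bool) -> bool) : cmd :=
  While (Cell (Const 2))
    (Seq (Store (Const 2) (Minus (Cell (Const 2)) (Const 1)))
         (Seq (Rand (Const 4) (Cell (Const 1))) (inspect d f))).

Definition tester (k d K : nat) (f : seq bool * seq (seq bool) -> bool) : cmd :=
  Seq (Store (Const 1) (Cell (Const 0)))
    (If (infeasible_expr k d) (Store (Const 0) (Const 0))
      (Seq (Store (Const 0) (Const 1))
        (If (Cell (Const 1))
          (Seq (Store (Const 3) (Const 1)) (Seq (counting K) (sampling d f)))
          skip))).

Variables (R : realType) (eps : R) (query : nat -> nat -> nat).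

Lemma good_run_halt b T rho m : (rho <= ((m 0 != 0) == b)%:R)%R ->
  good_run eps query b T rho ([::], m).
Proof. by case: T. Qed.

(** Here [S] is an a priori bound for the search and [i] the number of rounds left; one round takes
    4 steps. *)
Lemma good_run_counting b T rho k K S i m :
    (K%:R < eps * S%:R)%R -> m 2 + i = S ->
    m 3 = (eps * (m 2)%:R <= K%:R)%R ->
    (forall m', m' 0 = m 0 -> m' 1 = m 1 -> m' 2 <= S ->
       (K%:R < eps * (m' 2)%:R)%R -> good_run eps query b T rho (k, m')) ->
  good_run eps query b ((i * 4).+1 + T) rho (counting K :: k, m).
Proof.
move=> KS; elim: i m => [|i IHi] m m2 m3 next.
  rewrite addSn; apply: good_run_step; first by [].
  rewrite addn0 in m2.
  by rewrite /= m3 m2 leNgt KS /=; apply: next; rewrite ?m2.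
rewrite addSn; apply: good_run_step; first by [].
rewrite /= m3; case: leP => [le|lt] /=; last first.
  apply: good_run_leq (next m _ _ _ _) => //; first by lia.
  by rewrite -m2 leq_addr.
rewrite (_ : i.+1 * 4 + T = ((i * 4).+1 + T).+3); last by lia.
do 3![apply: good_run_step; first by []].
by apply: IHi => //; rewrite /update /=; lia.
Qed.

(** [g i fl] bounds from below the probability of output [b] with [i] samples to go and acceptance
    flag [fl]; the second hypothesis averages over one sample. A round takes 5 steps besides the
    inspection. *)
Lemma good_run_sampling b d f n (g : nat -> bool -> R) i m :
    (forall fl, g 0 fl <= (fl == b)%:R)%R ->
    (forall i fl, g i.+1 fl <=
      (\sum_(x < n.+1) g i (fl && ~~ f (pattern query d x))) / n.+1%:R)%R ->
    m 1 = n.+1 -> m 2 = i ->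
  good_run eps query b (i * (cost (inspect d f) + 5)).+1 (g i (m 0 != 0))
    ([:: sampling d f], m).
Proof.
move=> g0 gS; elim: i m => [|i IHi] m m1 m2.
  apply: good_run_step; first by [].
  by rewrite /= m2; apply: good_run_halt.
apply: good_run_step; first by [].
rewrite [eval _ _]/= m2 [_ != 0]/=.
rewrite (_ : i.+1 * _ =
   (cost (inspect d f) + (i * (cost (inspect d f) + 5)).+1).+4); last by lia.
do 3![apply: good_run_step; first by []].
set m' := update _ _ _.
have [h p] : good_run eps query b
   (cost (inspect d f) + (i * (cost (inspect d f) + 5)).+1).+1
   ((\sum_(x < n.+1) g i ((m 0 != 0) && ~~ f (pattern query d x))) / n.+1%:R)%R
   ([:: Rand (Const 4) (Cell (Const 1)); inspect d f; sampling d f], m').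
  apply: (good_run_rand (rho := fun x =>
    g i ((m 0 != 0) && ~~ f (pattern query d x)))) => // x ltx.
  apply: good_run_straight; first exact: straight_inspect.
  set m'' := update m' _ _.
  have [e0 e1 e2] := exec_inspect eps query d f m''.
  have -> : (m 0 != 0) && ~~ f (pattern query d x) =
     (exec eps query (inspect d f) m'' 0 != 0).
    by rewrite e0 /m'' /m' /update /=; case: ifP => _; rewrite ?andbT ?andbF.
  apply: IHi; rewrite ?e1 ?e2 /m'' /m' /update //=.
  by rewrite m2 subn1.
by split=> //; apply: le_trans p.
Qed.

End Tester.

Section TesterRuns.
Variables (R : realType) (eps : R) (query : nat -> nat -> nat).
Variables (k d K : nat) (f : seq bool * seq (seq bool) -> bool).
Hypothesis eps_gt0 : (0 < eps)%R.

Definition sample_bound : nat := (Num.trunc (K%:R / eps)).+1.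

(** The 9 counts the steps before the counting loop; the two other summands bound the loops. *)
Definition time_bound : nat :=
  9 + ((sample_bound * 4).+1 +
       (sample_bound * (cost (inspect d f) + 5)).+1).

Lemma sample_boundP : (K%:R < eps * sample_bound%:R)%R.
Proof. by rewrite mulrC -ltr_pdivrMr // truncnS_gt. Qed.

Lemma good_run_infeasible n : infeasible k d n ->
  good_run eps query false time_bound 1%R (start (tester k d K f) n).
Proof.
move=> bad; do 3![apply: good_run_step; first by []].
rewrite eval_infeasible bad; apply: good_run_step; first by [].
by apply: good_run_halt; rewrite lexx.
Qed.

Lemma good_run_empty : ~~ infeasible k d 0 ->
  good_run eps query true time_bound 1%R (start (tester k d K f) 0).
Proof.
move=> ok; do 3![apply: good_run_step; first by []].
rewrite eval_infeasible (negPf ok).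
do 4![apply: good_run_step; first by []].
by apply: good_run_halt; rewrite lexx.
Qed.

Lemma good_run_feasible b n (g : nat -> bool -> R) rho :
    ~~ infeasible k d n.+1 ->
    (forall fl, g 0 fl <= (fl == b)%:R)%R ->
    (forall i fl, g i.+1 fl <=
      (\sum_(x < n.+1) g i (fl && ~~ f (pattern query d x))) / n.+1%:R)%R ->
    (forall s, K%:R < eps * s%:R -> rho <= g s true)%R ->
  good_run eps query b time_bound rho (start (tester k d K f) n.+1).
Proof.
move=> ok g0 gS grho; do 3![apply: good_run_step; first by []].
rewrite eval_infeasible (negPf ok).
do 6![apply: good_run_step; first by []].
apply: (@good_run_counting _ _ _ _ _ _ _ _ sample_bound) => //.
- exact: sample_boundP.
- by rewrite mulr0 ler0n.
move=> m' m'0 m'1 m'2 Klt.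
have [h p] := @good_run_sampling _ eps query b d f n g (m' 2) m' g0 gS m'1 erefl.
apply: (good_run_leq (T := (m' 2 * (cost (inspect d f) + 5)).+1)).
  by rewrite ltnS leq_mul2r m'2 orbT.
by split=> //; apply: le_trans p; rewrite m'0; apply: grho.
Qed.

End TesterRuns.

(** * Probability of missing all typed vertices *)

Section Sampling.
Variable R : realType.
Local Open Scope ring_scope.

Lemma mean_indicator n (A : {set 'I_n.+1}) (rho : R) :
  (\sum_(x < n.+1) (if x \in A then 1 else rho)) / n.+1%:R =
  1 - (1 - #|A|%:R / n.+1%:R) * (1 - rho).
Proof.
have -> : \sum_(x < n.+1) (if x \in A then 1 else rho) =
    n.+1%:R * rho + #|A|%:R * (1 - rho).
  transitivity (\sum_(x < n.+1) (rho + (if x \in A then 1 - rho else 0))).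
    by apply: eq_bigr => x _; case: ifP => _; rewrite ?addr0 // addrC subrK.
  rewrite big_split /= sumr_const card_ord -big_mkcond /= sumr_const.
  by rewrite !mulr_natl.
have : n.+1%:R != 0 :> R by rewrite pnatr_eq0.
move: (n.+1%:R) (#|A|%:R) => N a N0.
by field.
Qed.

(** Bernoulli's inequality in reciprocal form; with [s * delta >= 2] it bounds the miss probability
    by 1/3. *)
Lemma expr_bernoulli (delta : R) s : 0 <= delta <= 1 ->
  (1 - delta) ^+ s * (1 + s%:R * delta) <= 1.
Proof.
case/andP=> d0 d1; elim: s => [|s IHs]; first by rewrite mul0r addr0 mulr1.
apply: le_trans IHs; rewrite exprSr -mulrA.
apply: ler_wpM2l; first by rewrite exprn_ge0 // subr_ge0.
have := ler0n R s; rewrite -natr1; nra.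
Qed.

Lemma miss_probability (delta : R) s : 0 <= delta <= 1 -> 2 <= s%:R * delta ->
  2 / 3 <= 1 - (1 - delta) ^+ s.
Proof.
move=> d01 sd; have := expr_bernoulli s d01.
have : 0 <= (1 - delta) ^+ s.
  by case/andP: d01 => _ d1; rewrite exprn_ge0 // subr_ge0.
by nra.
Qed.

End Sampling.

(** * Correctness of the tester *)

Lemma infeasible_typed B d n (H : sgraph 'I_n) :
    infeasible #|ball_vertex B|.-1 d n -> max_degree_le d H ->
  typed B H != set0.
Proof.
case/andP=> /eqP k0 bad dH; apply/eqP => T0.
have degH v : 0 < degree H v.
  have : v \in typed B H = false by rewrite T0 inE.
  by rewrite typed_small ?k0 // lt0n => ->.
case: n => [|n] in H bad dH T0 degH *.
  by case: (d == 0) bad => //; case: (d == 1).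
move: bad; case: (eqVneq d 0) => [d0 _|_].
  by have := dH ord0; rewrite d0 leqNgt degH.
case: (eqVneq d 1) => [d1 oddn|_ /eqP[n0]].
  (* All degrees are 1, so the degree sum is the odd number [n]. *)
  have := handshake H; rewrite (eq_bigr (fun=> 1)) ?sum1_card ?card_ord ?oddn //.
  by move=> v _; apply/eqP; rewrite eqn_leq degH andbT -d1; apply: dH.
have /card_gt0P[x] := degH ord0; rewrite inE.
have -> : x = ord0 by apply/ord_inj; have := ltn_ord x; rewrite /=; lia.
by rewrite edge_irr.
Qed.

Lemma far_many_typed (R : realType) (eps : R) B d n (G : sgraph 'I_n)
    (P : graph_property) :
    (0 < eps)%R -> (forall H : sgraph 'I_n, typed B H = set0 -> P 'I_n H) ->
    ~~ infeasible #|ball_vertex B|.-1 d n -> max_degree_le d G ->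
    far d P eps G ->
  (eps * n%:R <= (correction_cost B)%:R * #|typed B G|%:R)%R.
Proof.
move=> eps_gt0 PE ok dG farG.
(* For [d = 0] the distance threshold is 0: a free [G] is not far from itself, and a typed vertex
   forces [k = 0] and thus an infeasible [n]. *)
have [d0|d_gt0] := posnP d.
  have [T0|[v vT]] := set_0Vmem (typed B G).
    have := farG G dG (PE _ T0).
    by rewrite edit_distance_refl d0 mulr0 mul0r ltxx.
  have degv := typed_degree vT; have := dG v.
  rewrite d0 leqn0 -/(degree G v) degv => /eqP k0.
  move: ok; rewrite /infeasible k0 d0 /= negbK => /eqP n0.
  by have := ltn_ord v; rewrite [X in _ < X]n0.
have k0V : #|ball_vertex B|.-1 = 0 ->
    #|'I_n| != 1 /\ (d = 1 -> ~~ odd #|'I_n|).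
  move=> k0; rewrite card_ord; move: ok; rewrite /infeasible k0 /=.
  by case: eqP d_gt0 => [->//|_ _]; case: eqP => [_|d1]; split=> //; lia.
have [H [dH TH eH]] := correct_typed (fun=> d_gt0) dG k0V.
have := farG H dH (PE _ TH) => /ltW lt.
(* The factor [d] of the distance threshold is dropped, as [d >= 1]. *)
rewrite -natrM; apply: le_trans (le_trans lt _); last by rewrite ler_nat.
by rewrite -mulrA ler_pM2l // -natrM ler_nat leq_pmull.
Qed.

Theorem theorem8p3 (R : realType) (d : nat) (tau : type1) :
  uniformly_testable_const_time R d (nbhd_free tau).
Proof.
have [B BE] := type_classP tau.
have freeP n (G : sgraph 'I_n) : nbhd_free tau G <-> typed B G = set0.
  split=> [free|T0 v /BE/typedP]; last by rewrite T0 inE.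
  by apply/eqP; rewrite -subset0; apply/subsetP => v /typedP/BE/free.
(* With this [K], more than [K / eps] samples at density at least [eps / correction_cost B] give an
   expected number of hits of at least 2. *)
pose k := #|ball_vertex B|.-1; pose K := 2 * correction_cost B.
(* The predicate ranges over graphs of all sizes, so the program is the same for every [n]. It is
   decided classically, which is enough because only its finite table on patterns enters the
   program. *)
pose f pat := `[< exists n (G : sgraph 'I_n) adj (v : 'I_n),
  [/\ max_degree_le d G, adjacency_lists G adj,
      pattern (oracle adj) d v = pat & ball_iso B (nbhd_ball G v)] >].
exists (tester k d K f), (fun eps => time_bound eps d K f).
move=> eps /andP[eps_gt0 _] n G adj dG adjG.
have fE (v : 'I_n) : f (pattern (oracle adj) d v) = (v \in typed B G).
  apply/asboolP/typedP => [|vB]; last by exists n, G, adj, v.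
  case=> n' [G' [adj' [v' [dG' adjG' eq_pat vB']]]].
  exact/(ball_iso_trans vB')/(pattern_iso dG' dG adjG' adjG).
have le231 : (2 / 3 <= 1 :> R)%R by lra.
have [bad|ok] := boolP (infeasible k d n).
  have [h p] := good_run_infeasible eps (oracle adj) K f bad.
  split=> [//|/freeP T0|_]; last exact: le_trans p.
  by exfalso; have := infeasible_typed bad dG; rewrite T0 eqxx.
case: n => [|n] in G adj dG adjG fE ok *.
  have [h p] := good_run_empty eps (oracle adj) K f ok.
  split=> [//|_|farG]; first exact: le_trans p.
  exfalso; have T0 : typed B G = set0 by apply/setP => -[].
  have := farG G dG (proj2 (freeP 0 G) T0).
  by rewrite edit_distance_refl mulr0 ltxx.
(* The trivial probability bound 0 extracts halting for every input graph. *)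
have [h _] : good_run eps (oracle adj) true (time_bound eps d K f) 0%R
    (start (tester k d K f) n.+1).
  apply: (@good_run_feasible _ _ _ _ _ _ _ eps_gt0 _ _
    (fun _ _ => 0%R)) => // i fl.
  by rewrite big1 // mul0r.
split=> [//|/freeP T0|farG].
  have [_ p] : good_run eps (oracle adj) true (time_bound eps d K f) 1%R
      (start (tester k d K f) n.+1).
    (* Without typed vertices the flag never falls, so acceptance is certain. *)
    apply: (@good_run_feasible _ _ _ _ _ _ _ eps_gt0 _ _
      (fun _ fl => fl%:R%R)) => // [[]//|i fl].
    rewrite (eq_bigr (fun=> fl%:R%R)) => [|x _]; last by rewrite fE T0 inE andbT.
    by rewrite sumr_const card_ord -[(_ *+ n.+1)%R]mulr_natr mulfK ?pnatr_eq0.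
  exact: le_trans p.
pose delta : R := (#|typed B G|%:R / n.+1%:R)%R.
have n1_gt0 : (0 < n.+1%:R :> R)%R by rewrite ltr0n.
have d01 : (0 <= delta <= 1)%R.
  rewrite divr_ge0 ?ler0n //= ler_pdivrMr // mul1r ler_nat.
  by rewrite -[X in _ <= X](card_ord n.+1) max_card.
have [_ p] : good_run eps (oracle adj) false (time_bound eps d K f) (2 / 3)%R
    (start (tester k d K f) n.+1); last exact: p.
(* While the flag stands, rejection needs a hit among the [i] remaining samples; once it has fallen,
   rejection is certain. *)
apply: (@good_run_feasible _ _ _ _ _ _ _ eps_gt0 _ _ (fun i fl =>
    if fl then 1 - (1 - delta) ^+ i else 1)%R) => //.
- by case; rewrite ?expr0 ?subrr.
- move=> i [].
    rewrite (eq_bigr (fun x => if x \in typed B G then 1 else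
      1 - (1 - delta) ^+ i)%R) => [|x _]; last by rewrite fE; case: (x \in _).
    by rewrite mean_indicator opprB addrCA subrr addr0 exprS.
  by rewrite sumr_const card_ord mulfV ?pnatr_eq0.
move=> s Ks; apply: miss_probability => //.
have many := far_many_typed eps_gt0 (fun H => proj2 (freeP n.+1 H)) ok dG farG.
have C_gt0 : (0 < (correction_cost B)%:R :> R)%R by rewrite ltr0n.
rewrite /delta mulrA ler_pdivlMr //.
move: Ks many C_gt0 n1_gt0; rewrite /K natrM.
move: (ler0n R s).
move: (s%:R%R) (n.+1%:R%R) (#|typed B G|%:R%R) ((correction_cost B)%:R%R).
move=> S N M C S_ge0 Ks many C_gt0 N_gt0; rewrite -(ler_pM2l C_gt0).
(* The chain is [2 * C * N <= S * eps * N <= C * S * M], from the sample count and from [many]. *)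
apply: (@le_trans _ _ (S * (eps * N))%R); last first.
  by rewrite [leRHS]mulrCA ler_wpM2l.
rewrite !mulrA (mulrC C) (mulrC S) ler_pM2r //; exact: ltW.
Qed.
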